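(* Let $n\ge 2$. The permutation group $G_n$ of $\mathbb Z_2^n$ generated by all local logic gates is equal to the group of all invertible affine transformations of the vector space $\mathbb Z_2^n$ over $\mathbb Z_2$. Furthermore, every local logic gate acting on coordinates $i<j$ has the form $$\begin{pmatrix} x_i \\ x_j \end{pmatrix}\longmapsto B\begin{pmatrix} x_i \\ x_j \end{pmatrix}+b$$ (with all other coordinates fixed), where $B\in \mathrm{GL}(2,\mathbb Z_2)$ and $b\in\mathbb Z_2^2$; its linear part is either the identity, an elementary matrix, or a product of two elementary matrices, and its translation part is a translation on at most two coordinates.
   Context: $\mathbb Z_2$ is the field with two elements; binary strings of length $n$ are identified with vectors in $\mathbb Z_2^n$. Local logic gate: let $\sigma$ be any permutation of the four-element set $\mathbb Z_2^2$ and let $1\le i<j\le n$. The induced permutation $\sigma_{i,j}$ of $\mathbb Z_2^n$ replaces the coordinates $(c_i,c_j)$ of a vector $(c_1,\dots,c_n)$ by the first and second components of $\sigma(c_i,c_j)$ respectively, and leaves all other coordinates unchanged. The permutations $\sigma_{i,j}$ are called local logic gates. An affine transformation of $\mathbb Z_2^n$ is a map $T v=Av+v_0$ with $A$ a linear map $\mathbb Z_2^n\to\mathbb Z_2^n$ (the linear part) and $v_0\in\mathbb Z_2^n$ (translation by $v_0$ is the translation part); it is invertible iff $A$ is. An elementary matrix over $\mathbb Z_2$ is a matrix of a row swap or of a row addition (adding one row to another). *)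

(* Defs.v *)
From mathcomp Require Import all_boot all_order all_fingroup all_algebra.

Set Implicit Arguments.
Unset Strict Implicit.
Unset Printing Implicit Defensive.

Import GRing.Theory.
Local Open Scope ring_scope.

Notation vec n := ('cV['F_2]_n).

Definition coords n (i j : 'I_n) (x : vec n) : vec 2 :=
  \col_(k < 2) x (if k == 0 then i else j) 0.

Definition gate_fun n (s : {perm (vec 2)}) (i j : 'I_n) (x : vec n) : vec n :=
  \col_k (if k == i then s (coords i j x) 0 0
          else if k == j then s (coords i j x) 1 0
          else x k 0).

Lemma coords_gate_fun n (s : {perm (vec 2)}) (i j : 'I_n) (x : vec n) :
  (i < j)%N -> coords i j (gate_fun s i j x) = s (coords i j x).
Proof.
move=> ij; have ji : (j == i) = false by apply: contraTF ij => /eqP->; rewrite ltnn.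
apply/colP=> k; rewrite !mxE; case: (eqVneq k 0) => [->|k0]; first by rewrite eqxx.
rewrite ji eqxx; congr (s _ _ _).
by apply/val_inj; case: k k0 => [[|[|]]].
Qed.

Lemma gate_fun_inj n (s : {perm (vec 2)}) (i j : 'I_n) :
  (i < j)%N -> injective (gate_fun s i j).
Proof.
move=> ij x y e.
have /perm_inj/colP exy : s (coords i j x) = s (coords i j y).
  by rewrite -!coords_gate_fun // e.
apply/colP=> k.
have := exy 0; have := exy 1; have := congr1 (fun v : vec n => v k 0) e.
rewrite !mxE /=; case: (eqVneq k i) => [->|_] // ; case: (eqVneq k j) => [->|_] //.
Qed.

Definition local_gate n (s : {perm (vec 2)}) (i j : 'I_n) (ij : (i < j)%N) :
  {perm (vec n)} := perm (gate_fun_inj (s := s) ij).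

Definition local_gates n : {set {perm (vec n)}} :=
  [set p : {perm (vec n)} |
    [exists s : {perm (vec 2)}, exists i : 'I_n, exists j : 'I_n,
      (i < j)%N && [forall x, p x == gate_fun s i j x]]].

Lemma local_gatesP n (p : {perm (vec n)}) :
  reflect (exists s (i j : 'I_n) (ij : (i < j)%N), p = local_gate s ij)
          (p \in local_gates n).
Proof.
rewrite inE; apply: (iffP idP).
  case/existsP=> s /existsP[i /existsP[j /andP[ij /forallP h]]].
  by exists s, i, j, ij; apply/permP=> x; rewrite permE (eqP (h x)).
case=> s [i [j [ij ->]]].
apply/existsP; exists s; apply/existsP; exists i; apply/existsP; exists j.
by rewrite ij; apply/forallP=> x; rewrite permE.
Qed.

Definition gate_group n : {set {perm (vec n)}} := <<local_gates n>>%g.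

Definition affine_map n (A : 'M['F_2]_n) (v0 x : vec n) : vec n := A *m x + v0.

Definition affine_perms n : {set {perm (vec n)}} :=
  [set p : {perm (vec n)} |
    [exists A : 'M['F_2]_n, (A \in unitmx) &&
      [exists v0 : vec n, forall x, p x == affine_map A v0 x]]].

Lemma affine_permsP n (p : {perm (vec n)}) :
  reflect (exists2 A : 'M['F_2]_n, A \in unitmx &
             exists v0 : vec n, forall x, p x = affine_map A v0 x)
          (p \in affine_perms n).
Proof.
rewrite inE; apply: (iffP existsP) => [[A /andP[uA /existsP[v /forallP h]]]|].
  by exists A => //; exists v => x; apply/eqP.
case=> A uA [v h]; exists A; rewrite uA; apply/existsP; exists v.
by apply/forallP=> x; apply/eqP.
Qed.

Lemma affine_perms_group_set n : group_set (affine_perms n).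
Proof.
apply/group_setP; split.
  apply/affine_permsP; exists 1%:M; first exact: unitmx1.
  by exists 0 => x; rewrite perm1 /affine_map mul1mx addr0.
move=> p q /affine_permsP[A uA [a hp]] /affine_permsP[B uB [b hq]].
apply/affine_permsP; exists (B *m A); first by rewrite unitmx_mul uB.
exists (B *m a + b) => x.
by rewrite permM hp hq /affine_map mulmxDr mulmxA addrA.
Qed.

Canonical affine_perms_group n : {group {perm (vec n)}} :=
  Group (affine_perms_group_set n).

(* Row swap, or addition of row s to row r; over F_2 the only nonzero scalar is 1, so there is
   no row scaling. *)
Definition elementary_mx n (E : 'M['F_2]_n) : Prop :=
  exists r s : 'I_n, r != s /\ (E = tperm_mx r s \/ E = 1%:M + delta_mx r s).

Definition at_most_two_elementary n (A : 'M['F_2]_n) : Prop :=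
  [\/ A = 1%:M, elementary_mx A |
      exists E F : 'M['F_2]_n,
        [/\ elementary_mx E, elementary_mx F & A = E *m F]].

(* Main.v *)
(* Every permutation of F_2^2 is affine, because the four vectors sum to zero.  With
   E : F_2^2 -> F_2^n the embedding into coordinates i and j (so E^T E = 1), a gate given by
   y |-> B y + b is x |-> (1 + E (B - 1) E^T) x + E b, and B |-> 1 + E (B - 1) E^T is
   multiplicative and preserves elementary matrices.  Conversely, gates include all row
   additions, which generate GL_n(F_2), and all translations by basis vectors. *)

Require Import Defs.
From mathcomp Require Import all_boot all_order all_fingroup all_algebra.

Set Implicit Arguments.
Unset Strict Implicit.
Unset Printing Implicit Defensive.

Import GRing.Theory.
Local Open Scope ring_scope.

(** * Arithmetic over ['F_2] and factorisation of invertible 2 by 2 matrices *)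

Lemma F2_cases (c : 'F_2) : c = 0 \/ c = 1.
Proof. by case: c => [[|[|m]] lt_m2] //; [left | right]; apply/val_inj. Qed.

Lemma F2_addmm m p (M : 'M['F_2]_(m, p)) : M + M = 0.
Proof.
by apply/matrixP=> i j; rewrite !mxE; case: (F2_cases (M i j)) => ->; apply/val_inj.
Qed.

Lemma F2_oppm m p (M : 'M['F_2]_(m, p)) : - M = M.
Proof. by apply/eqP; rewrite eq_sym -addr_eq0 F2_addmm. Qed.

Lemma ord2_cases (k : 'I_2) : k = 0 \/ k = 1.
Proof. by case: k => [[|[|m]] lt_m2] //; [left | right]; apply/val_inj. Qed.

Lemma det_mx2 (R : comPzRingType) (A : 'M[R]_2) :
  \det A = A 0 0 * A 1 1 - A 0 1 * A 1 0.
Proof.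
rewrite (expand_det_row A 0) !big_ord_recl big_ord0 addr0 /cofactor !det_mx11 !mxE /=.
rewrite expr0 expr1 mul1r mulN1r mulrN.
by congr (A _ _ * A _ _ - A _ _ * A _ _); apply/val_inj.
Qed.

Lemma eq_mx2 (R : Type) (A B : 'M[R]_2) :
  A 0 0 = B 0 0 -> A 0 1 = B 0 1 -> A 1 0 = B 1 0 -> A 1 1 = B 1 1 -> A = B.
Proof.
move=> e00 e01 e10 e11; apply/matrixP=> i j.
by case: (ord2_cases i) (ord2_cases j) => -> [] ->.
Qed.

Lemma GL2_F2_elementary (B : 'M['F_2]_2) : B \in unitmx -> at_most_two_elementary B.
Proof.
rewrite unitmxE unitfE det_mx2 => detB.
pose W : 'M['F_2]_2 := tperm_mx 0 1.
pose T01 : 'M['F_2]_2 := 1%:M + delta_mx 0 1.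
pose T10 : 'M['F_2]_2 := 1%:M + delta_mx 1 0.
have eW : elementary_mx W by exists 0, 1; split=> //; left.
have e01 : elementary_mx T01 by exists 0, 1; split=> //; right.
have e10 : elementary_mx T10 by exists 1, 0; split=> //; right.
have dec : [\/ B = 1%:M, B = W, B = T01 | [\/ B = T10, B = W *m T01 | B = W *m T10]].
  move: detB.
  (* A nonzero determinant leaves six of the sixteen entry patterns; the constructors follow the
     order in which these six cases appear. *)
  have [] := F2_cases (B 0 0); have [] := F2_cases (B 0 1);
    have [] := F2_cases (B 1 0); have [] := F2_cases (B 1 1) => b11 b10 b01 b00;
    rewrite b11 b10 b01 b00 // => _;
  [constructor 2 | constructor 4; constructor 2 | constructor 1
   | constructor 4; constructor 1 | constructor 3 | constructor 4; constructor 3];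
  by apply: eq_mx2; rewrite ?b00 ?b01 ?b10 ?b11 /W /T01 /T10 -?row_permE !mxE ?permE /=;
    apply/val_inj.
case: dec => [|||[]] dB.
- by constructor 1.
- by constructor 2; rewrite dB.
- by constructor 2; rewrite dB.
- by constructor 2; rewrite dB.
- by constructor 3; exists W, T01.
- by constructor 3; exists W, T10.
Qed.

(** * Permutations of the four-vector plane are affine *)

Lemma F2_additive_mulmx m p (f : 'cV['F_2]_m -> 'cV['F_2]_p) :
  {morph f : x y / x + y} -> {A : 'M['F_2]_(p, m) | forall x, f x = A *m x}.
Proof.
move=> fD; have f0 : f 0 = 0 by rewrite -[X in f X](F2_addmm (0 : 'cV_m)) fD F2_addmm.
(* The columns are the images of the basis vectors; as the only scalars are 0 and 1, additivity
   already gives linearity. *)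
exists (\matrix_(k, l) f (delta_mx l 0) k 0) => x.
rewrite {1}[x]matrix_sum_delta.
transitivity (\sum_i x i 0 *: f (delta_mx i 0)).
  rewrite (big_morph f fD f0); apply: eq_bigr => i _.
  rewrite big_ord1; case: (F2_cases (x i 0)) => ->; first by rewrite !scale0r.
  by rewrite !scale1r.
apply/colP=> k; rewrite summxE mxE; apply: eq_bigr => i _.
by rewrite !mxE mulrC.
Qed.

(** The vectors 0, [x], [y], [x + y] are pairwise distinct, and the plane has only four vectors. *)
Lemma vec2_sum_four (x y : vec 2) : x != 0 -> y != 0 -> x != y ->
  forall f : vec 2 -> vec 2, \sum_z f z = f 0 + (f x + (f y + f (x + y))).
Proof.
move=> x0 y0 xy f; pose r := [:: 0; x; y; x + y].
have ur : uniq r.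
  rewrite /= !inE !negb_or ![0 == _]eq_sym x0 y0 xy addr_eq0 F2_oppm xy.
  rewrite -subr_eq0 opprD addrA subrr sub0r oppr_eq0 y0.
  by rewrite -subr_eq0 opprD addrCA subrr addr0 oppr_eq0 x0.
have rT z : z \in r.
  have /eqP : #|[predC r]| = 0%N.
    apply/eqP; rewrite -(eqn_add2l #|r|) cardC addn0 card_mx card_Fp //.
    by rewrite (card_uniqP ur).
  by move/pred0P/(_ z)/negbFE.
rewrite (eq_bigl (mem r)) => [|z]; last by rewrite [mem r z]rT.
by rewrite -big_uniq //= !big_cons big_nil addr0.
Qed.

(* The values of a permutation of F_2^2 at 0, x, y, x + y sum to the sum of all four
   vectors, which vanishes; hence z |-> s z + s 0 is additive. *)
Lemma perm_vec2_affine (s : {perm (vec 2)}) :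
  exists (B : 'M['F_2]_2) (b : vec 2), forall x, s x = B *m x + b.
Proof.
have fD : {morph (fun z => s z + s 0) : x y / x + y}.
  move=> x y /=; have [->|x0] := eqVneq x 0; first by rewrite add0r F2_addmm add0r.
  have [->|y0] := eqVneq y 0; first by rewrite addr0 F2_addmm addr0.
  have [->|xy] := eqVneq x y; first by rewrite !F2_addmm.
  have four := vec2_sum_four x0 y0 xy.
  have : \sum_z s z = 0.
    rewrite -(reindex_inj (h := s) (F := id) (P := xpredT)) /=; last exact: perm_inj.
    by rewrite four add0r addrA F2_addmm.
  rewrite four => sum0.
  rewrite [RHS]addrACA F2_addmm addr0; apply/eqP; rewrite -subr_eq0 F2_oppm.
  by apply/eqP; rewrite -[RHS]sum0 -addrA addrC !addrA.
have [B hB] := F2_additive_mulmx fD; exists B, (s 0) => x.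
by rewrite -hB -addrA F2_addmm addr0.
Qed.

Lemma affine_map_inj n (A : 'M['F_2]_n) (v0 : vec n) :
  A \in unitmx -> injective (affine_map A v0).
Proof. by move=> uA x y /addIr /(congr1 (mulmx (invmx A))); rewrite !mulKmx. Qed.

Lemma perm_affine_unit n (p : {perm (vec n)}) (A : 'M['F_2]_n) (v0 : vec n) :
  (forall x, p x = affine_map A v0 x) -> A \in unitmx.
Proof.
(* [p] sends column [l] of [W] to the [l]-th basis vector plus [v0], so [A] sends it to that basis
   vector: surjectivity of [p] yields a right inverse. *)
move=> pA; pose W := \matrix_(k, l) ((p^-1)%g (delta_mx l 0 + v0)) k 0.
have AW : A *m W = 1%:M.
  apply/matrixP=> k l; have := pA ((p^-1)%g (delta_mx l 0 + v0)).
  rewrite permKV => /addIr/colP/(_ k); rewrite !mxE eqxx andbT => ->.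
  by apply: eq_bigr => h _; rewrite !mxE.
by case: (mulmx1_unit AW).
Qed.

(** * Lifting 2 by 2 matrices to the coordinates [i] and [j] *)

Lemma delta_mulmx (R : pzRingType) m p q (r : 'I_m) (k : 'I_p) (M : 'M[R]_(p, q)) :
  delta_mx r k *m M = delta_mx r (0 : 'I_1) *m row k M.
Proof. by rewrite rowE mulmxA mul_delta_mx. Qed.

Lemma delta_mulmx_col (R : comPzRingType) m p (r : 'I_m) (k : 'I_p) (x : 'cV[R]_p) :
  delta_mx r k *m x = x k 0 *: delta_mx r 0.
Proof.
rewrite delta_mulmx [row k x]mx11_scalar mul_mx_scalar; congr (_ *: _).
by rewrite mxE.
Qed.

Definition embed_mx n (i j : 'I_n) : 'M['F_2]_(n, 2) := delta_mx i 0 + delta_mx j 1.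

(** For [i != j] this acts as [B] on coordinates [i], [j] and as the identity elsewhere; the
    subtracted [1%:M] cancels the identity on those two coordinates. *)
Definition lift2_mx n (i j : 'I_n) (B : 'M['F_2]_2) : 'M['F_2]_n :=
  1%:M + embed_mx i j *m (B - 1%:M) *m (embed_mx i j)^T.

Lemma embed_mxE n (i j : 'I_n) (y : vec 2) :
  embed_mx i j *m y = y 0 0 *: delta_mx i 0 + y 1 0 *: delta_mx j 0.
Proof. by rewrite mulmxDl !delta_mulmx_col. Qed.

Lemma tr_embed_mx n (i j : 'I_n) :
  (embed_mx i j)^T = delta_mx 0 i + delta_mx 1 j.
Proof. by rewrite /embed_mx linearD /= !trmx_delta. Qed.

Lemma coordsE n (i j : 'I_n) (x : vec n) : coords i j x = (embed_mx i j)^T *m x.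
Proof.
rewrite tr_embed_mx mulmxDl !delta_mulmx_col; apply/colP=> k; rewrite !mxE.
by case: (ord2_cases k) => -> /=; rewrite ?mulr1 ?mulr0 ?addr0 ?add0r.
Qed.

Lemma tr_embed_mxK n (i j : 'I_n) : i != j -> (embed_mx i j)^T *m embed_mx i j = 1%:M.
Proof.
move=> ij; rewrite tr_embed_mx mulmxDl !mulmxDr !mul_delta_mx.
rewrite (mul_delta_mx_0 _ _ _ ij) mul_delta_mx_0 1?eq_sym // addr0 add0r.
by apply: eq_mx2; rewrite !mxE /=; apply/val_inj.
Qed.

(** Replaces the case distinction on coordinates by a correction term, so that the rest is matrix
    algebra. *)
Lemma gate_funE n (s : {perm (vec 2)}) (i j : 'I_n) (x : vec n) : i != j ->
  gate_fun s i j x = x + embed_mx i j *m (s (coords i j x) - coords i j x).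
Proof.
move=> ij; rewrite embed_mxE; set y := s _.
apply/colP=> k; rewrite !mxE -/y /= !andbT.
have [->|ki] := eqVneq k i.
  by rewrite (negPf ij) mulr1 mulr0 addr0 addrC subrK.
have [->|kj] := eqVneq k j; first by rewrite mulr1 mulr0 add0r addrC subrK.
by rewrite !mulr0 !addr0.
Qed.

Lemma gate_fun_affine n (s : {perm (vec 2)}) (B : 'M['F_2]_2) (b : vec 2) (i j : 'I_n) :
  i != j -> (forall y, s y = B *m y + b) ->
  forall x, gate_fun s i j x = affine_map (lift2_mx i j B) (embed_mx i j *m b) x.
Proof.
move=> ij sB x; rewrite gate_funE // sB coordsE /affine_map /lift2_mx.
rewrite mulmxDl mul1mx -!addrA; congr (_ + _).
by rewrite -!mulmxA -mulmxDr mulmxBl mul1mx addrAC -addrA.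
Qed.

Lemma lift2_mx1 n (i j : 'I_n) : lift2_mx i j 1%:M = 1%:M.
Proof. by rewrite /lift2_mx subrr mulmx0 mul0mx addr0. Qed.

(** Since E^T E = 1, the middle factors combine as (B - 1) + (C - 1) + (B - 1)(C - 1) = BC - 1. *)
Lemma lift2_mxM n (i j : 'I_n) (B C : 'M['F_2]_2) : i != j ->
  lift2_mx i j (B *m C) = lift2_mx i j B *m lift2_mx i j C.
Proof.
move=> ij; rewrite /lift2_mx; set E := embed_mx i j.
rewrite mulmxDl mul1mx mulmxDr mulmx1 -!addrA; congr (_ + _).
rewrite -!mulmxA [E^T *m (E *m _)]mulmxA tr_embed_mxK // mul1mx.
rewrite [(B - _) *m (_ *m _)]mulmxA -!mulmxDr -!mulmxDl; congr (_ *m (_ *m _)).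
rewrite mulmxBr mulmx1 [X in _ = _ + X]addrC subrK mulmxBl mul1mx.
by rewrite [RHS]addrC addrA subrK.
Qed.

Lemma embed_delta_mx n (i j : 'I_n) (r s : 'I_2) :
  embed_mx i j *m delta_mx r s *m (embed_mx i j)^T =
  delta_mx (if r == 0 then i else j) (if s == 0 then i else j).
Proof.
rewrite tr_embed_mx mulmxDl !mul_delta_mx_cond.
by case: (ord2_cases r) => ->; rewrite !(mulr1n, mulr0n, addr0, add0r);
  rewrite mulmxDr !mul_delta_mx_cond; case: (ord2_cases s) => ->;
  rewrite !(mulr1n, mulr0n, addr0, add0r).
Qed.

(** Signs vanish in characteristic two; in this form [embed_delta_mx] carries a swap through the
    lift term by term. *)
Lemma tperm_mx_F2 n (r s : 'I_n) : r != s ->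
  tperm_mx r s =
    1%:M + (delta_mx r r + delta_mx r s + (delta_mx s r + delta_mx s s)) :> 'M['F_2]_n.
Proof.
move=> rs; have sr := rs; rewrite eq_sym in sr.
apply/matrixP=> a b; rewrite !mxE; case: tpermP => [->|->|/eqP ar /eqP as_].
- rewrite eqxx (negPf rs) /= ![_ == b]eq_sym; have [->|_] := eqVneq b r.
    by rewrite (negPf rs); apply/val_inj.
  by rewrite !add0r addr0.
- rewrite eqxx (negPf sr) /= ![_ == b]eq_sym; have [->|_] := eqVneq b s.
    by rewrite (negPf sr); apply/val_inj.
  by rewrite !add0r addr0.
by rewrite (negPf ar) (negPf as_) !addr0.
Qed.

Lemma elementary_lift2_mx n (i j : 'I_n) (B : 'M['F_2]_2) : i != j ->
  elementary_mx B -> elementary_mx (lift2_mx i j B).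
Proof.
move=> ij [r [s [rs eB]]]; pose f (k : 'I_2) := if k == 0 then i else j.
have frs : f r != f s.
  by case: (ord2_cases r) (ord2_cases s) rs => -> [] -> // _; rewrite /f /= 1?eq_sym.
exists (f r), (f s); split=> //; case: eB => ->; [left | right]; last first.
  by rewrite /lift2_mx [_ - 1%:M]addrC addKr embed_delta_mx.
rewrite !tperm_mx_F2 // /lift2_mx [_ - 1%:M]addrC addKr.
have := embed_delta_mx i j; move: (embed_mx i j) => E ED.
by rewrite !mulmxDr !mulmxDl !ED.
Qed.

Lemma at_most_two_lift2_mx n (i j : 'I_n) (B : 'M['F_2]_2) : i != j ->
  at_most_two_elementary B -> at_most_two_elementary (lift2_mx i j B).
Proof.
move=> ij [->|eB|[E [F [eE eF ->]]]].
- by constructor 1; rewrite lift2_mx1.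
- by constructor 2; apply: elementary_lift2_mx.
constructor 3; exists (lift2_mx i j E), (lift2_mx i j F).
by split; rewrite ?lift2_mxM //; apply: elementary_lift2_mx.
Qed.

Lemma card_support_embed n (i j : 'I_n) (b : vec 2) :
  (#|[set k : 'I_n | ((embed_mx i j *m b) k 0 != 0)%R]| <= 2)%N.
Proof.
apply: leq_trans (_ : #|[set i; j]| <= 2)%N; last by rewrite cards2; case: (_ != _).
apply/subset_leq_card/subsetP=> k; rewrite !inE embed_mxE !mxE !andbT.
by apply: contraR; rewrite negb_or => /andP[/negPf-> /negPf->]; rewrite !mulr0 addr0.
Qed.

(** * Row additions generate the general linear group over ['F_2] *)

Lemma row_transvection n (A : 'M['F_2]_n) (v : 'cV['F_2]_n) (k : 'I_n) :
  A + v *m row k A = (1%:M + v *m delta_mx 0 k) *m A.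
Proof. by rewrite mulmxDl mul1mx -mulmxA -rowE. Qed.

(** As [v k 0 = 0], row [k] is unchanged, so the second addition cancels the first in characteristic
    two. *)
Lemma row_transvectionK n (A : 'M['F_2]_n) (v : 'cV['F_2]_n) (k : 'I_n) :
  v k 0 = 0 -> let B := A + v *m row k A in B + v *m row k B = A.
Proof.
move=> vk B; have vk0 : row k v = 0 by apply/matrixP=> a b; rewrite !mxE !ord1.
by rewrite [row k B]linearD /= row_mul vk0 mul0mx addr0 -addrA F2_addmm addr0.
Qed.

(** Row [k] is added to the rows selected by [v] one at a time, and it stays intact because [v] does
    not select it. *)
Lemma transvection_ind n (P : 'M['F_2]_n -> Prop) :
  (forall A r s, r != s -> P A -> P ((1%:M + delta_mx r s) *m A)) ->
  forall A (v : 'cV['F_2]_n) k, v k 0 = 0 -> P A -> P (A + v *m row k A).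
Proof.
move=> Pdelta A v k vk PA.
(* [w s] is the part of [v] treated so far; each new index costs one row addition. *)
pose w (s : seq 'I_n) := \sum_(r <- s | r != k) v r 0 *: delta_mx r (0 : 'I_1).
have wk s : row k (w s) = 0.
  apply/rowP=> b; rewrite ord1 !mxE summxE big1 // => r rk.
  by rewrite !mxE eq_sym (negPf rk) mulr0.
have Pw s : P (A + w s *m row k A).
  elim: s => [|r s IHs]; first by rewrite /w big_nil mul0mx addr0.
  have [->|rk] := eqVneq r k; first by rewrite /w big_cons eqxx.
  have -> : w (r :: s) = v r 0 *: delta_mx r 0 + w s by rewrite /w big_cons rk.
  case: (F2_cases (v r 0)) => ->; first by rewrite scale0r add0r.
  rewrite scale1r; suff -> : A + (delta_mx r 0 + w s) *m row k A =
    (1%:M + delta_mx r k) *m (A + w s *m row k A) by apply: Pdelta.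
  rewrite mulmxDl [RHS]mulmxDl mul1mx [delta_mx r k *m _]delta_mulmx.
  by rewrite [row k (A + _)]linearD /= row_mul wk mul0mx addr0 addrCA addrC.
suff -> : v = w (index_enum 'I_n) by [].
rewrite {1}[v]matrix_sum_delta /w [RHS]big_mkcond /=; apply: eq_bigr => r _.
by rewrite big_ord1; case: eqVneq => [->|//]; rewrite vk scale0r.
Qed.

(** Otherwise column [k] is supported on rows above [k], where [A] acts as the identity. Then [A]
    sends both this column and the [k]-th basis vector to the column itself, so the two agree, yet
    their entries at [k] differ. *)
Lemma unitmx_pivot n (A : 'M['F_2]_n) (k : 'I_n) : A \in unitmx ->
  (forall i l : 'I_n, (l < k)%N -> A i l = (i == l)%:R) ->
  exists2 r : 'I_n, (k <= r)%N & A r k = 1.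
Proof.
move=> uA Astd.
have [r /andP[kr /eqP Ark]|A0] := pickP (fun r : 'I_n => (k <= r)%N && (A r k == 1)).
  by exists r.
have {}A0 (r : 'I_n) : (k <= r)%N -> A r k = 0.
  by move=> kr; have := A0 r; rewrite kr /=; case: (F2_cases (A r k)) => ->.
have : A *m col k A = A *m delta_mx k 0.
  rewrite -[A *m delta_mx _ _]colE -[RHS]mul1mx; apply/colP=> i; rewrite !mxE.
  apply: eq_bigr => l _; rewrite !mxE.
  by case: (ltnP l k) => lk; [rewrite (Astd i l) | rewrite (A0 l) // !mulr0].
move/(congr1 (mulmx (invmx A))); rewrite !mulKmx // => /colP/(_ k)/eqP.
by rewrite !mxE !eqxx A0.
Qed.

(* Gauss-Jordan elimination on the columns from left to right; every row operation used is
   an involution, so it can be undone by the closure property of P. *)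
Lemma unitmx_F2_ind n (P : 'M['F_2]_n -> Prop) :
  P 1%:M ->
  (forall A r s, r != s -> P A -> P ((1%:M + delta_mx r s) *m A)) ->
  forall A, A \in unitmx -> P A.
Proof.
move=> P1 Pdelta.
have Pback (A : 'M_n) (v : 'cV_n) k : v k 0 = 0 -> P (A + v *m row k A) -> P A.
  move=> vk PB; rewrite -(row_transvectionK A vk).
  exact: transvection_ind.
have uback (A : 'M['F_2]_n) (v : 'cV_n) k :
    v k 0 = 0 -> A \in unitmx -> A + v *m row k A \in unitmx.
  move=> vk; rewrite -{1}(row_transvectionK A vk) /= row_transvection unitmx_mul.
  by case/andP.
have entry (A : 'M_n) (v : 'cV['F_2]_n) k i l : (A + v *m row k A) i l = A i l + v i 0 * A k l.
  by rewrite !mxE big_ord1 mxE.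
(* [m] counts the columns still to be reduced: [m = n] assumes nothing, and [m = 0] forces the
   identity. *)
suff H m A : (m <= n)%N -> A \in unitmx ->
    (forall i l : 'I_n, (l < n - m)%N -> A i l = (i == l)%:R) -> P A.
  by move=> A uA; apply: (H n) => // i l; rewrite subnn.
elim: m A => [|m IHm] A mn uA Astd.
  suff -> : A = 1%:M by [].
  by apply/matrixP=> i l; rewrite mxE Astd // subn0.
have kn : (n - m.+1 < n)%N by rewrite ltn_subrL (leq_ltn_trans _ mn).
pose k := Ordinal kn.
have pivot1 B : B \in unitmx -> B k k = 1 ->
    (forall i l : 'I_n, (l < k)%N -> B i l = (i == l)%:R) -> P B.
  (* Column [k] without its pivot: adding row [k] along [v] clears the column, and earlier columns
     survive because row [k] vanishes there. *)
  move=> uB Bkk Bstd; pose v : 'cV['F_2]_n := \col_i (if i == k then 0 else B i k).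
  have vk : v k 0 = 0 by rewrite mxE eqxx.
  apply: (Pback _ v k vk); apply: IHm; [exact: ltnW | exact: uback |].
  move=> i l lm; rewrite entry mxE.
  have : (l <= k)%N by rewrite -ltnS /= -subSn.
  rewrite leq_eqVlt => /orP[/eqP/val_inj->|lk]; last first.
    by rewrite (Bstd i l) // (Bstd k l) // -[k == l]val_eqE (gtn_eqF lk) mulr0 addr0.
  have [->|ik] := eqVneq i k; first by rewrite Bkk mul0r addr0.
  by rewrite Bkk mulr1; case: (F2_cases (B i k)) => ->; apply/val_inj.
have [r kr Ark] := unitmx_pivot (k := k) uA Astd.
have [Akk|Akk] := F2_cases (A k k); last exact: pivot1.
have rk : r != k by apply/eqP=> rk; move: Ark; rewrite rk Akk.
(* With a zero diagonal entry, adding row [r] to row [k] creates the pivot. *)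
have vr : (delta_mx k 0 : 'cV['F_2]_n) r 0 = 0 by rewrite mxE (negPf rk).
apply: (Pback _ _ _ vr); apply: pivot1; first exact: uback.
  by rewrite entry mxE !eqxx Akk Ark; apply/val_inj.
move=> i l lk; rewrite entry !Astd //.
by rewrite -[r == l]val_eqE (gtn_eqF (leq_trans lk kr)) mulr0 addr0.
Qed.

(** * Linear maps and translations realised by gates *)

Lemma gate_group_affine_gate n (i j : 'I_n) (ij : (i < j)%N) (B : 'M['F_2]_2) (b : vec 2) :
  B \in unitmx ->
  exists2 p, p \in gate_group n &
    forall x, p x = affine_map (lift2_mx i j B) (embed_mx i j *m b) x.
Proof.
move=> uB; pose s := perm (affine_map_inj (v0 := b) uB).
exists (local_gate s ij); first by apply/mem_gen/local_gatesP; exists s, i, j, ij.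
move=> x; rewrite permE; apply: gate_fun_affine => [|y]; first by rewrite -val_eqE ltn_eqF.
by rewrite permE.
Qed.

Lemma transvection_unit n (r s : 'I_n) : r != s ->
  (1%:M + delta_mx r s : 'M['F_2]_n) \in unitmx.
Proof.
move=> rs; pose T : 'M['F_2]_n := 1%:M + delta_mx r s.
suff /mulmx1_unit[] : T *m T = 1%:M by [].
rewrite mulmxDl mul1mx mulmxDr mulmx1 mul_delta_mx_0 1?eq_sym // addr0.
by rewrite -addrA F2_addmm addr0.
Qed.

Lemma gate_group_transvection n (r s : 'I_n) : r != s ->
  exists2 p, p \in gate_group n & forall x, p x = (1%:M + delta_mx r s) *m x.
Proof.
move=> rs; case: (ltngtP r s) => [lt_rs|lt_sr|/val_inj eq_rs]; last by rewrite eq_rs eqxx in rs.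
(* A gate lists the smaller index first, so the order of [r] and [s] decides which off-diagonal
   entry of the 2 by 2 matrix is set. *)
- have [//|p Gp hp] := gate_group_affine_gate lt_rs 0 (@transvection_unit 2 0 1 _).
  exists p => // x; rewrite hp /affine_map mulmx0 addr0 /lift2_mx.
  by rewrite [_ - 1%:M]addrC addKr embed_delta_mx.
have [//|p Gp hp] := gate_group_affine_gate lt_sr 0 (@transvection_unit 2 1 0 _).
exists p => // x; rewrite hp /affine_map mulmx0 addr0 /lift2_mx.
by rewrite [_ - 1%:M]addrC addKr embed_delta_mx.
Qed.

Lemma gate_group_linear n (A : 'M['F_2]_n) : A \in unitmx ->
  exists2 p, p \in gate_group n & forall x, p x = A *m x.
Proof.
move: A; apply: unitmx_F2_ind => [|A r s rs [p Gp hp]].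
  by exists 1%g => [|x]; [exact: group1 | rewrite perm1 mul1mx].
have [q Gq hq] := gate_group_transvection rs.
by exists (p * q)%g => [|x]; [exact: groupM | rewrite permM hp hq mulmxA].
Qed.

Lemma gate_group_translation n (v : vec n) : (2 <= n)%N ->
  exists2 p, p \in gate_group n & forall x, p x = x + v.
Proof.
move=> n_ge2; pose T (u : vec n) := exists2 p, p \in gate_group n & forall x, p x = x + u.
have T0 : T 0 by exists 1%g => [|x]; [exact: group1 | rewrite perm1 addr0].
have TD u w : T u -> T w -> T (u + w).
  move=> [p Gp hp] [q Gq hq].
  by exists (p * q)%g => [|x]; [exact: groupM | rewrite permM hp hq addrA].
have Tgate (i j : 'I_n) b : (i < j)%N -> T (embed_mx i j *m b).
  move=> ij; have [p Gp hp] := gate_group_affine_gate ij b (unitmx1 _ _).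
  by exists p => // x; rewrite hp /affine_map lift2_mx1 mul1mx.
have Tdelta k : T (delta_mx k 0).
  (* A gate needs a second coordinate, which [n_ge2] provides: 1 when [k] is 0, and 0 otherwise. *)
  have [k' kk'] : exists k' : 'I_n, k' != k.
    have [k0|k0] := eqVneq (k : nat) 0%N.
      by exists (Ordinal n_ge2); rewrite -val_eqE /= k0.
    by exists (Ordinal (ltnW n_ge2)); rewrite -val_eqE /= eq_sym.
  case: (ltngtP k k') => [lt_kk'|lt_k'k|/val_inj e]; last by rewrite e eqxx in kk'.
    have := Tgate _ _ (delta_mx 0 0) lt_kk'.
    by rewrite embed_mxE !mxE /= scale1r scale0r addr0.
  have := Tgate _ _ (delta_mx 1 0) lt_k'k.
  by rewrite embed_mxE !mxE /= scale1r scale0r add0r.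
rewrite -/(T v) [v]matrix_sum_delta; apply: (big_ind T) => // k _.
by rewrite big_ord1; case: (F2_cases (v k 0)) => ->; rewrite ?scale0r ?scale1r.
Qed.

(** * Equality of the two groups and the shape of a single gate *)

Theorem theorem3p3 (n : nat) (n_ge2 : (2 <= n)%N) :
  gate_group n = affine_perms n
  /\ forall (s : {perm (vec 2)}) (i j : 'I_n) (ij : (i < j)%N),
       (exists (B : 'M['F_2]_2) (b : vec 2),
          [/\ B \in unitmx,
              forall x : vec n,
                coords i j (local_gate s ij x) = B *m coords i j x + b,
              forall (x : vec n) (k : 'I_n), k != i -> k != j ->
                local_gate s ij x k 0 = x k 0
            & at_most_two_elementary B])
       /\ (exists (A : 'M['F_2]_n) (v0 : vec n),
          [/\ forall x : vec n, local_gate s ij x = affine_map A v0 x,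
              at_most_two_elementary A
            & (#|[set k : 'I_n | (v0 k 0 != 0)%R]| <= 2)%N]).
Proof.
have gateE (s : {perm (vec 2)}) (i j : 'I_n) (ij : (i < j)%N) :
  exists (B : 'M['F_2]_2) (b : vec 2),
    [/\ B \in unitmx, forall y, s y = B *m y + b &
        forall x, local_gate s ij x = affine_map (lift2_mx i j B) (embed_mx i j *m b) x].
  have [B [b sB]] := perm_vec2_affine s; exists B, b; split=> //.
    exact: perm_affine_unit sB.
  by move=> x; rewrite permE; apply: gate_fun_affine; rewrite // -val_eqE ltn_eqF.
split.
  apply/eqP; rewrite eqEsubset; apply/andP; split.
    rewrite gen_subG; apply/subsetP=> p /local_gatesP[s [i [j [ij ->]]]].
    have [B [b [_ _ hB]]] := gateE s i j ij.
    apply/affine_permsP; exists (lift2_mx i j B); first exact: perm_affine_unit hB.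
    by exists (embed_mx i j *m b).
  apply/subsetP=> p /affine_permsP[A uA [v hp]].
  have [q Gq hq] := gate_group_linear uA.
  have [t Gt ht] := gate_group_translation v n_ge2.
  (* Products of permutations apply the left factor first: the linear part, then the translation. *)
  suff -> : p = (q * t)%g by apply: groupM.
  by apply/permP=> x; rewrite permM hp ht hq.
move=> s i j ij; have [B [b [uB sB hB]]] := gateE s i j ij.
have ij' : i != j by rewrite -val_eqE ltn_eqF.
have eB := GL2_F2_elementary uB; split.
  exists B, b; split=> // [x|x k ki kj]; first by rewrite permE coords_gate_fun.
  by rewrite permE mxE (negPf ki) (negPf kj).
exists (lift2_mx i j B), (embed_mx i j *m b); split=> //.
  exact: at_most_two_lift2_mx.
exact: card_support_embed.
Qed.
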